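(* For the proportional case of the online removable multiple knapsack problem with $k$ bins, for every $k\ge 2$, every randomized online algorithm has competitive ratio at least $1.2$; that is, for every randomized online algorithm $A$ there are inputs $I$ with $\mathrm{OPT}_k(I)/\mathbb{E}[A_k(I)]$ at least, or arbitrarily close to, $1.2$.
   Context: Online removable multiple knapsack: there are $k$ bins (knapsacks), each of capacity $1$. Items arrive one by one; each item has a size in $(0,1]$ and a value. Upon arrival of an item, the online algorithm must either reject it or pack it into one of the bins; at any time the algorithm may also remove previously packed items from their bins, after which they count as rejected forever. At all times the total size of items in each bin must be at most $1$. The profit $A_k(I)$ of the algorithm on input $I$ is the total value of items packed at the end. $\mathrm{OPT}_k(I)$ denotes the maximum total value of a subset of the items of $I$ that can be packed into $k$ bins of capacity $1$. In the proportional case each item's value equals its size. The competitive ratio of a randomized algorithm is $\sup_I \mathrm{OPT}_k(I)/\mathbb{E}[A_k(I)]$. *)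

(* Defs.v *)
From HB Require Import structures.
From mathcomp Require Import all_boot all_order all_algebra.
From mathcomp Require Import all_classical all_reals all_analysis.

Set Implicit Arguments.
Unset Strict Implicit.
Unset Printing Implicit Defensive.

Import Order.TTheory GRing.Theory Num.Theory.

Local Open Scope classical_set_scope.
Local Open Scope ring_scope.

Record item (R : realType) := Item { item_size : R; item_value : R }.

Definition item_class (R : realType) := item R -> Prop.

Definition proportional (R : realType) : item_class R :=
  fun x => 0 < item_size x <= 1 /\ item_value x = item_size x.

Definition input_of (R : realType) (C : item_class R) (I : seq (item R)) : Prop :=
  forall i, (i < size I)%N -> C (nth (Item 0 0) I i).

(* A packing of an input lists, in order of arrival, the bin holding each item;
   [None] means that the item was rejected or has been removed. *)
Definition packing (k : nat) := seq (option 'I_k).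

Definition load (R : realType) (k : nat) (I : seq (item R)) (p : packing k)
    (b : 'I_k) : R :=
  \sum_(xo <- zip I p | xo.2 == Some b) item_size xo.1.

Definition feasible (R : realType) (k : nat) (I : seq (item R))
    (p : packing k) : bool :=
  (size p == size I) && [forall b : 'I_k, load I p b <= 1].

Definition profit (R : realType) (k : nat) (I : seq (item R))
    (p : packing k) : R :=
  \sum_(xo <- zip I p | xo.2 != None) item_value xo.1.

(* The default value 0 of the maximum is the profit of the empty packing. *)
Definition OPT (R : realType) (k : nat) (I : seq (item R)) : R :=
  \big[Num.max/0]_(p : (size I).-tuple (option 'I_k) | feasible I p) profit I p.

(* [keep_or_remove p q]: after the arrival of one more item, [q] leaves every
   earlier item in the bin that [p] assigned to it or removes it for good; the
   last entry of [q], which concerns the new item, is unconstrained. *)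
Definition keep_or_remove (k : nat) (p q : packing k) : bool :=
  all2 (fun old new => (new == None) || (new == old)) p (take (size p) q).

(* An algorithm maps the items that have arrived so far to its current packing;
   it is not told which items follow. *)
Definition online_algorithm (R : realType) (k : nat) (C : item_class R)
    (A : seq (item R) -> packing k) : Prop :=
  (forall I, input_of C I -> feasible I (A I)) /\
  (forall I x, input_of C (rcons I x) -> keep_or_remove (A I) (A (rcons I x))).

(* A random choice of deterministic algorithm. Packings of a given input form a
   finite set, so the last condition makes [A ^~ I] a discrete random
   variable. *)
Definition randomized_online_algorithm (R : realType) (k : nat)
    (C : item_class R) (d : measure_display) (T : measurableType d)
    (A : T -> seq (item R) -> packing k) : Prop :=
  (forall w, online_algorithm C (A w)) /\
  (forall I (p : packing k), input_of C I -> measurable [set w | A w I = p]).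

Definition expected_profit (R : realType) (k : nat) (d : measure_display)
    (T : measurableType d) (P : probability T R)
    (A : T -> seq (item R) -> packing k) (I : seq (item R)) : \bar R :=
  'E_P[fun w => profit I (A w I)].

(* In [\bar R], [r%:E / 0 = +oo] for [r > 0], and [0 / 0 = 0]. *)
Definition competitive_ratio (R : realType) (k : nat) (C : item_class R)
    (d : measure_display) (T : measurableType d) (P : probability T R)
    (A : T -> seq (item R) -> packing k) : \bar R :=
  ereal_sup [set ((OPT k I)%:E / expected_profit P A I)%E | I in input_of C].

(* Main.v *)
(* For small e > 0, let k items of size 1/3 + 2e arrive, then k items of size
   2/3 - e, and finally k items of size either 2/3 - 2e or 1/3 + e. In both cases
   OPT = k, each late item filling a bin with one early item of the appropriate
   kind. Early items of different kinds do not share a bin, so before the last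
   block each bin is committed to one kind, and its loads after the two
   continuations sum to at most 1 + (2/3 + 4e). The two expected profits thus sum
   to at most k (5/3 + 4e), so one of the ratios is at least 1 / (5/6 + 2e), which
   tends to 6/5. *)
Require Import Defs.
From HB Require Import structures.
From mathcomp Require Import all_boot all_order all_algebra.
From mathcomp Require Import all_classical all_reals all_analysis.
From mathcomp Require Import measurable_realfun zify ring lra.

Set Implicit Arguments.
Unset Strict Implicit.
Unset Printing Implicit Defensive.

Import Order.TTheory GRing.Theory Num.Theory.

Local Open Scope ring_scope.

(** * Loads, profits and removals *)

Lemma load_cat (R : realType) (k : nat) (I J : seq (item R)) (p q : packing k)
    (b : 'I_k) : size I = size p ->
  load (I ++ J) (p ++ q) b = load I p b + load J q b.
Proof. by move=> sIp; rewrite /load zip_cat// big_cat. Qed.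

Lemma load_nseq (R : realType) (k n : nat) (a : item R) (p : packing k)
    (b : 'I_k) : size p = n ->
  load (nseq n a) p b = item_size a * (count_mem (Some b) p)%:R.
Proof.
move=> <-; rewrite /load; elim: p => [|o p IHp] /=; first by rewrite big_nil mulr0.
rewrite big_cons IHp /=; case: eqP => _ /=; last by rewrite add0n.
by rewrite natrD mulrDr mulr1.
Qed.

(** Each packed item lies in exactly one bin and is worth its size, so values regroup by bin; this
    lets profits be bounded one bin at a time. *)
Lemma profit_load (R : realType) (k : nat) (I : seq (item R)) (p : packing k) :
  input_of (@proportional R) I -> profit I p = \sum_(b < k) load I p b.
Proof.
rewrite /profit /load; elim: I p => [|a I IH] [|o p] hI /=;
  do ?[by rewrite !big_nil big1// => b _; rewrite big_nil].
rewrite big_cons; under [RHS]eq_bigr do rewrite big_cons.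
have IH' := IH p (fun i => hI i.+1).
case: o => [b|] /=; last by rewrite IH'; apply: eq_bigr.
rewrite IH' (hI 0%N isT).2 /= [in RHS](bigD1 b)//= eqxx (bigD1 b)//= addrA.
congr (_ + _); apply: eq_bigr => c cb.
rewrite (_ : (Some b == Some c) = false)//; apply/negbTE; rewrite eq_sym.
by apply: contra cb => /eqP[->].
Qed.

Lemma keep_or_remove_trans (k : nat) (p q r : packing k) :
  (size p <= size q)%N ->
  keep_or_remove p q -> keep_or_remove q r -> keep_or_remove p r.
Proof.
rewrite /keep_or_remove; elim: p q r => [|a p IH] [|b q] [|c r]//= spq.
move=> /andP[ab pq] /andP[bc qr]; apply/andP; split; last exact: IH pq qr.
by case/orP: bc => [->//|/eqP->].
Qed.

Lemma keep_or_remove_refl (k : nat) (p : packing k) : keep_or_remove p p.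
Proof.
by rewrite /keep_or_remove take_size; elim: p => //= a p ->; rewrite eqxx orbT.
Qed.

Lemma input_of_catl (R : realType) (C : item_class R) (I J : seq (item R)) :
  input_of C (I ++ J) -> input_of C I.
Proof.
move=> h i iI; have := h i; rewrite nth_cat iI size_cat; apply.
exact: ltn_addr.
Qed.

Lemma online_keep_or_remove (R : realType) (k : nat) (C : item_class R)
    (A : seq (item R) -> packing k) (I J : seq (item R)) :
  online_algorithm C A -> input_of C (I ++ J) ->
  keep_or_remove (A I) (A (I ++ J)).
Proof.
move=> [fA kA]; elim/last_ind: J => [|J x IH].
  by rewrite cats0 => _; exact: keep_or_remove_refl.
rewrite -rcons_cat => h.
have hIJ : input_of C (I ++ J) by apply: (@input_of_catl _ _ _ [:: x]); rewrite cats1.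
apply: keep_or_remove_trans (IH hIJ) (kA _ _ h).
have /andP[/eqP-> _] := fA _ hIJ.
have /andP[/eqP-> _] := fA _ (@input_of_catl _ _ _ _ hIJ).
by rewrite size_cat leq_addr.
Qed.

Lemma keep_or_remove_cat (k : nat) (p1 p2 q1 q2 q3 : packing k) :
  size p1 = size q1 -> size p2 = size q2 ->
  keep_or_remove (p1 ++ p2) (q1 ++ q2 ++ q3) ->
  keep_or_remove p1 q1 && keep_or_remove p2 q2.
Proof.
move=> s1 s2; rewrite /keep_or_remove s1 s2 !take_size catA take_size_cat ?size_cat ?s1 ?s2//.
by rewrite !all2E zip_cat// all_cat !size_cat s1 s2 !eqxx.
Qed.

(** An entry [Some b] of [q] is not a removal, so it was already [Some b] in [p]. *)
Lemma keep_or_remove_count (k : nat) (p q : packing k) (b : 'I_k) :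
  size p = size q -> keep_or_remove p q ->
  (count_mem (Some b) q <= count_mem (Some b) p)%N.
Proof.
rewrite /keep_or_remove => ->; rewrite take_size.
elim: p q => [|o p IH] [|o' q]//= /andP[oo pq]; apply: leq_add (IH _ pq).
by case/orP: oo => /eqP->.
Qed.

Lemma feasible_load (R : realType) (k : nat) (I : seq (item R)) (p : packing k)
    (b : 'I_k) : feasible I p -> load I p b <= 1.
Proof. by move=> /andP[_ /forallP]. Qed.

(** * Inputs made of blocks of equal items, and the arithmetic of one bin *)

Definition blocks (R : realType) (n : nat) (ss : seq R) : seq (item R) :=
  flatten [seq nseq n (Item s s) | s <- ss].

Lemma blocks_proportional (R : realType) (n : nat) (ss : seq R) :
  all (fun s => 0 < s <= 1) ss -> input_of (@proportional R) (blocks n ss).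
Proof.
rewrite /blocks; elim: ss => [|s ss IH] /= => [_ []//|/andP[s01 ss01]] i.
rewrite size_cat size_nseq nth_cat size_nseq nth_nseq => ilt.
case: ltnP => ni; first by split.
apply: IH => //.
by rewrite ltn_subLR.
Qed.

Lemma size_blocks (R : realType) (n : nat) (ss : seq R) :
  size (blocks n ss) = (size ss * n)%N.
Proof. by rewrite /blocks; elim: ss => //= s ss IH; rewrite size_cat size_nseq IH mulSn. Qed.

Lemma load_blocks (R : realType) (k n : nat) (ss : seq R) (ps : seq (packing k))
    (b : 'I_k) : all (fun p => size p == n) ps -> size ps = size ss ->
  load (blocks n ss) (flatten ps) b =
  \sum_(sp <- zip ss ps) sp.1 * (count_mem (Some b) sp.2)%:R.
Proof.
elim: ss ps => [|s ss IH] [|p ps]//=; first by rewrite /load !big_nil.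
move=> /andP[/eqP sp hps] [e].
by rewrite load_cat ?size_nseq// load_nseq// IH// big_cons.
Qed.

(** Recovers the block structure in an algorithm's packing, of which only the total length is
    known. *)
Lemma split_packing (k n m : nat) (p : packing k) : size p = (m * n)%N ->
  exists ps, [/\ p = flatten ps, all (fun p => size p == n) ps & size ps = m].
Proof.
elim: m p => [|m IH] p; first by move/size0nil->; exists [::].
rewrite mulSn => sp.
have [|ps [eps aps sps]] := IH (drop n p); first by rewrite size_drop sp addKn.
exists (take n p :: ps); split => /=; rewrite -?eps ?cat_take_drop ?sps//.
by rewrite aps size_take_min sp andbT; apply/eqP/minn_idPl; rewrite leq_addr.
Qed.

(* The [m]s, [n]s and [l]s count the items of one bin, by size, after the first
   two blocks and at the end of the two possible continuations. Once the bin
   holds an item of size 2/3 - e it holds none of size 1/3 + 2e, and the first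
   continuation fits only one of its items there; otherwise the second
   continuation leaves at most two items in it. *)
Lemma bin_bound (R : realType) (e : R) (m1 m2 n1 n2 n3 l1 l2 l3 : nat) :
  0 < e -> e < 1 / 30 -> (n1 <= m1)%N -> (n2 <= m2)%N -> (l2 <= m2)%N ->
  (1 / 3 + 2 * e) * m1%:R + (2 / 3 - e) * m2%:R <= 1 ->
  (1 / 3 + 2 * e) * n1%:R + (2 / 3 - e) * n2%:R + (2 / 3 - 2 * e) * n3%:R <= 1 ->
  (1 / 3 + 2 * e) * l1%:R + (2 / 3 - e) * l2%:R + (1 / 3 + e) * l3%:R <= 1 ->
  ((1 / 3 + 2 * e) * n1%:R + (2 / 3 - e) * n2%:R + (2 / 3 - 2 * e) * n3%:R)
  + ((1 / 3 + 2 * e) * l1%:R + (2 / 3 - e) * l2%:R + (1 / 3 + e) * l3%:R)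
  <= 5 / 3 + 4 * e.
Proof.
move=> e0 e30 nm1 nm2 lm2 hm hn hl.
have pos (m : nat) : 0 <= m%:R :> R by exact: ler0n.
have epos (m : nat) : 0 <= e * m%:R by rewrite mulr_ge0// ltW.
have lpos (m : nat) : 0 <= (1 / 30 - e) * m%:R by rewrite mulr_ge0// subr_ge0 ltW.
have [m20|m2_gt0] := posnP m2.
  have n20 : n2 = 0%N by lia.
  have l20 : l2 = 0%N by lia.
  have l2le : (l1 + l3 <= 2)%N.
    rewrite leqNgt; apply/negP => h3.
    have : 3 <= l1%:R + l3%:R :> R by rewrite -natrD (ler_nat R).
    have := epos l1; have := epos l3; have := lpos l1; have := lpos l3.
    have := pos l1; have := pos l3.
    by move: hl; rewrite l20; nra.
  (* Two items of size at most [1 / 3 + 2 * e] load at most [2 / 3 + 4 * e], and the first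
     continuation at most 1; this case dictates the constant. *)
  have : l1%:R + l3%:R <= 2 :> R by rewrite -natrD (ler_nat R).
  have := epos l1; have := epos l3; have := pos l1; have := pos l3.
  by move: hn hl; rewrite n20 l20; nra.
(* The two early sizes sum to [1 + e], which exceeds the capacity. *)
have m10 : m1 = 0%N.
  apply/eqP; rewrite -leqn0 leqNgt; apply/negP => m1_gt0.
  have : 1 <= m1%:R :> R by rewrite ler1n.
  have : 1 <= m2%:R :> R by rewrite ler1n.
  by have := epos m1; have := lpos m2; have := pos m1; have := pos m2; nra.
have n10 : n1 = 0%N by lia.
(* Two such items have total size at least [4 / 3 - 4 * e], above 1 because [e < 1 / 30]. *)
have n1le : (n2 + n3 <= 1)%N.
  rewrite leqNgt; apply/negP => h2.
  have : 2 <= n2%:R + n3%:R :> R by rewrite -natrD (ler_nat R).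
  have := lpos n2; have := lpos n3; have := pos n2; have := pos n3.
  by move: hn; rewrite n10; nra.
have : n2%:R + n3%:R <= 1 :> R by rewrite -natrD lern1.
have := epos n3; have := epos n2; have := pos n2; have := pos n3.
by move: hn hl; rewrite n10; nra.
Qed.

(** * An online algorithm on two inputs with a common prefix *)

Lemma blocks_cat (R : realType) (n : nat) (ss ts : seq R) :
  blocks n (ss ++ ts) = blocks n ss ++ blocks n ts.
Proof. by rewrite /blocks map_cat flatten_cat. Qed.

(** Supplies the counts [m1] and [m2] of [bin_bound]. *)
Lemma online_load_base (R : realType) (k : nat) (A : seq (item R) -> packing k)
    (x y : R) (b : 'I_k) :
  online_algorithm (@proportional R) A ->
  input_of (@proportional R) (blocks k [:: x; y]) ->
  let p := A (blocks k [:: x; y]) in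
  load (blocks k [:: x; y]) p b =
  x * (count_mem (Some b) (take k p))%:R + y * (count_mem (Some b) (drop k p))%:R.
Proof.
move=> [fA _] hI p; have /andP[/eqP] := fA _ hI; rewrite -/p size_blocks /=.
move=> /split_packing[ps [-> hps sps]] _.
case: ps hps sps => [|p1 [|p2 [|? ?]]] //= /and3P[/eqP s1 /eqP s2 _] _.
rewrite take_cat drop_cat s1 ltnn subnn take0 drop0 !cats0.
by rewrite /blocks /= load_cat ?size_nseq// cats0 !load_nseq//.
Qed.

(** The packing [p] is fixed before [z] is known, and afterwards early items can only leave their
    bin. Using this with two values of [z] compares both continuations with the same [p]. *)
Lemma online_load_branch (R : realType) (k : nat)
    (A : seq (item R) -> packing k) (x y z : R) (b : 'I_k) :
  online_algorithm (@proportional R) A ->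
  input_of (@proportional R) (blocks k [:: x; y; z]) ->
  let p := A (blocks k [:: x; y]) in
  exists n1 n2 n3,
    [/\ (n1 <= count_mem (Some b) (take k p))%N,
        (n2 <= count_mem (Some b) (drop k p))%N &
        load (blocks k [:: x; y; z]) (A (blocks k [:: x; y; z])) b =
        x * n1%:R + y * n2%:R + z * n3%:R].
Proof.
move=> hA hxyz p.
have e3 : blocks k [:: x; y; z] = blocks k [:: x; y] ++ blocks k [:: z].
  by rewrite -blocks_cat.
have hxy : input_of (@proportional R) (blocks k [:: x; y]).
  by move: hxyz; rewrite e3; exact: input_of_catl.
have := hxyz; rewrite {1}e3 => /(online_keep_or_remove hA); rewrite -e3 -/p.
have /andP[/eqP] := hA.1 _ hxyz; set q := A _; rewrite size_blocks /=.
move=> /split_packing[qs [-> hqs sqs]] _.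
case: qs hqs sqs => [|q1 [|q2 [|q3 [|? ?]]]] //= /and4P[t1 t2 t3 _] _.
have /andP[/eqP] := hA.1 _ hxy; rewrite -/p size_blocks /=.
move=> /split_packing[ps [-> hps sps]] _.
case: ps hps sps => [|p1 [|p2 [|? ?]]] //= /and3P[/eqP s1 /eqP s2 _] _.
rewrite take_cat drop_cat s1 ltnn subnn take0 drop0 !cats0.
move=> /keep_or_remove_cat; rewrite s1 s2 (eqP t1) (eqP t2) => /(_ erefl erefl).
move=> /andP[k1 k2].
exists (count_mem (Some b) q1), (count_mem (Some b) q2), (count_mem (Some b) q3).
split; [apply: keep_or_remove_count k1|apply: keep_or_remove_count k2|].
- by rewrite s1 (eqP t1).
- by rewrite s2 (eqP t2).
have := @load_blocks _ k k [:: x; y; z] [:: q1; q2; q3] b; rewrite /= t1 t2 t3 cats0.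
by move=> ->//; rewrite !big_cons big_nil addr0 addrA.
Qed.

Lemma branches_proportional (R : realType) (k : nat) (e : R) :
  0 < e -> e < 1 / 30 ->
  input_of (@proportional R)
    (blocks k [:: 1 / 3 + 2 * e; 2 / 3 - e; 2 / 3 - 2 * e]) /\
  input_of (@proportional R)
    (blocks k [:: 1 / 3 + 2 * e; 2 / 3 - e; 1 / 3 + e]).
Proof. by move=> e0 e30; split; apply: blocks_proportional => /=; lra. Qed.

Lemma online_profit_bound (R : realType) (k : nat)
    (A : seq (item R) -> packing k) (e : R) : 0 < e -> e < 1 / 30 ->
  online_algorithm (@proportional R) A ->
  (let I1 := blocks k [:: 1 / 3 + 2 * e; 2 / 3 - e; 2 / 3 - 2 * e] in
   let I2 := blocks k [:: 1 / 3 + 2 * e; 2 / 3 - e; 1 / 3 + e] in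
   profit I1 (A I1) + profit I2 (A I2)) <= k%:R * (5 / 3 + 4 * e).
Proof.
move=> e0 e30 hA /=; have [h1 h2] := branches_proportional k e0 e30.
rewrite !profit_load// -big_split /=.
have -> : k%:R * (5 / 3 + 4 * e) = \sum_(b < k) (5 / 3 + 4 * e).
  by rewrite sumr_const card_ord mulr_natl.
apply: ler_sum => b _.
have h0 : input_of (@proportional R) (blocks k [:: 1 / 3 + 2 * e; 2 / 3 - e]).
  by apply: blocks_proportional => /=; lra.
have [n1 [n2 [n3 [nm1 nm2 E1]]]] := online_load_branch b hA h1.
have [l1 [l2 [l3 [lm1 lm2 E2]]]] := online_load_branch b hA h2.
have := feasible_load b (hA.1 _ h0); rewrite online_load_base//.
have := feasible_load b (hA.1 _ h1); have := feasible_load b (hA.1 _ h2).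
rewrite E1 E2 => hl hn hm.
exact: (bin_bound e0 e30 nm1 nm2 lm2 hm hn hl).
Qed.

(** * Lower bounds on the optimum *)

Lemma OPT_ge_profit (R : realType) (k : nat) (I : seq (item R)) (p : packing k) :
  feasible I p -> profit I p <= OPT k I.
Proof.
move=> fp; have /andP[sp _] := fp.
by rewrite /OPT (le_bigmax_cond _ (fun q : _.-tuple _ => profit I q) (j := Tuple sp)).
Qed.

(** Bin number [i] receives the [i]-th item of every block selected by [bs]; the selected sizes sum
    to 1, so all [k] bins are exactly full. *)
Lemma OPT_blocks_ge (R : realType) (k : nat) (ss : seq R) (bs : bitseq) :
  all (fun s => 0 < s <= 1) ss -> size bs = size ss ->
  \sum_(s <- mask bs ss) s = 1 -> k%:R <= OPT k (blocks k ss).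
Proof.
move=> ss01 sbs sum1; set E := map Some (enum 'I_k) : packing k.
pose ps : seq (packing k) := [seq if c then E else nseq k None | c <- bs].
have sps : all (fun p => size p == k) ps.
  by apply/allP => p /mapP[[] _ ->]; rewrite ?size_nseq// size_map size_enum_ord.
have loadE b : load (blocks k ss) (flatten ps) b = 1.
  rewrite load_blocks ?size_map// -[RHS]sum1 /ps.
  elim: bs ss sbs {ss01 sum1 ps sps} => [|c bs IH] [|s ss]//=.
    by rewrite !big_nil.
  move=> [sbs]; rewrite big_cons IH//=; case: c => /=.
    rewrite big_cons count_map (eq_count (a2 := pred1 b)); last by [].
    by rewrite count_uniq_mem ?enum_uniq// mem_enum mulr1.
  by rewrite count_nseq mulr0 add0r.
suff f : feasible (blocks k ss) (flatten ps).
  apply: le_trans (OPT_ge_profit f).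
  rewrite profit_load; last exact: blocks_proportional.
  by under eq_bigr do rewrite loadE; rewrite sumr_const card_ord.
apply/andP; split; last by apply/forallP => b; rewrite loadE.
rewrite size_blocks -sbs -(size_map (fun c => if c then E else nseq k None) bs) -/ps.
elim: ps sps {loadE} => //= p ps IH /andP[/eqP sp hps].
by rewrite size_cat sp (eqP (IH hps)) mulSn.
Qed.

(** * Expected profit and the competitive ratio *)

Lemma measurable_profit (R : realType) (k : nat) (C : item_class R)
    (d : measure_display) (T : measurableType d)
    (A : T -> seq (item R) -> packing k) (I : seq (item R)) :
  randomized_online_algorithm C A -> input_of C I ->
  measurable_fun setT (fun w => profit I (A w I)).
Proof.
move=> [_ mA] hI _ Y _; rewrite setTI.
(* Packings form a countable type, so the preimage is a countable union over them. The second factor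
   does not depend on [w], hence is everything or empty. *)
rewrite (_ : _ @^-1` Y = \bigcup_p ([set w | A w I = p] `&` [set _ | Y (profit I p)]))%classic.
  apply: countable_bigcupT_measurable => [|p].
    exact: (@countableP (seq (option 'I_k))).
  apply: measurableI; first exact: mA.
  have [Yp|Yp] := pselect (Y (profit I p)).
    by have -> : [set _ : T | Y (profit I p)]%classic = setT by apply/seteqP; split.
  by have -> : [set _ : T | Y (profit I p)]%classic = set0 by apply/seteqP; split.
apply/seteqP; split => [w Yw|w [p _ [<-]]]; last by [].
by exists (A w I).
Qed.

Lemma profit_ge0 (R : realType) (k : nat) (I : seq (item R)) (p : packing k) :
  input_of (@proportional R) I -> 0 <= profit I p.
Proof.
rewrite /profit; elim: I p => [|a I IH] [|o p] hI /=; rewrite ?big_nil//.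
rewrite big_cons; have [/andP[a0 _] aE] := hI 0%N isT.
have IHp := IH p (fun i => hI i.+1).
by case: ifP => // _; rewrite addr_ge0// aE ltW.
Qed.

(** Every outcome [w] yields a deterministic online algorithm, so [online_profit_bound] holds
    pointwise and is integrated against a measure of total mass 1. *)
Lemma expected_profit_bound (R : realType) (k : nat) (d : measure_display)
    (T : measurableType d) (P : probability T R)
    (A : T -> seq (item R) -> packing k) (e : R) : 0 < e -> e < 1 / 30 ->
  randomized_online_algorithm (@proportional R) A ->
  (expected_profit P A (blocks k [:: (1 / 3 + 2 * e)%R; (2 / 3 - e)%R; (2 / 3 - 2 * e)%R])
  + expected_profit P A (blocks k [:: (1 / 3 + 2 * e)%R; (2 / 3 - e)%R; (1 / 3 + e)%R])
  <= (k%:R * (5 / 3 + 4 * e))%:E)%E.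
Proof.
move=> e0 e30 hA; have [h1 h2] := branches_proportional k e0 e30.
rewrite /expected_profit unlock -ge0_integralD//=.
- rewrite -[leRHS]mule1 -(@probability_setT _ _ _ P) -integral_cst//.
  apply: ge0_le_integral => //.
  + by move=> w _; rewrite adde_ge0// lee_fin profit_ge0.
  + apply: emeasurable_funD; apply/measurable_EFinP; exact: measurable_profit hA _.
  + by move=> w _; rewrite lee_fin; apply: online_profit_bound => //; exact: hA.1.
- by move=> w _; rewrite lee_fin profit_ge0.
- by apply/measurable_EFinP; exact: measurable_profit hA _.
- by move=> w _; rewrite lee_fin profit_ge0.
- by apply/measurable_EFinP; exact: measurable_profit hA _.
Qed.

Lemma competitive_ratio_ge (R : realType) (k : nat) (C : item_class R)
    (d : measure_display) (T : measurableType d) (P : probability T R)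
    (A : T -> seq (item R) -> packing k) (I : seq (item R)) (a b : R) :
  input_of C I -> 0 < a -> 0 < b -> a <= OPT k I ->
  (0 <= expected_profit P A I)%E -> (expected_profit P A I <= b%:E)%E ->
  ((a / b)%:E <= competitive_ratio C P A)%E.
Proof.
move=> hI a0 b0 aI E0 Eb; apply: ereal_sup_ge.
exists ((OPT k I)%:E / expected_profit P A I)%E; first by exists I.
have OPT0 : 0 < OPT k I by exact: lt_le_trans aI.
have EE : expected_profit P A I \is a fin_num.
  by rewrite ge0_fin_numE//; apply: le_lt_trans Eb _; rewrite ltry.
move: E0 Eb; rewrite -(fineK EE) !lee_fin => r0 rb; rewrite inver.
(* With zero expected profit the ratio is [+oo], since [OPT k I] is positive. *)
case: eqP => [_|/eqP rn0]; first by rewrite gt0_muley ?leey// lte_fin.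
have r0' : 0 < fine (expected_profit P A I) by rewrite lt_neqAle eq_sym rn0.
rewrite -EFinM lee_fin; apply: ler_pM => //; first exact: ltW.
- by rewrite invr_ge0 ltW.
- by rewrite lef_pV2.
Qed.

Theorem theorem2 (R : realType) (k : nat) (hk : (2 <= k)%N)
    (d : measure_display) (T : measurableType d) (P : probability T R)
    (A : T -> seq (item R) -> packing k)
    (hA : randomized_online_algorithm (@proportional R) A) :
  ((6 / 5 : R)%:E <= competitive_ratio (@proportional R) P A)%E.
Proof.
have k0 : 0 < k%:R :> R by rewrite ltr0n; lia.
(* It suffices to reach 6/5 up to a slack [t]. Clearing the denominator [5 / 6 + 2 * e] leaves
   [12 / 5 * e <= 5 / 6 * t + 2 * t * e], which follows from [e <= t / 3]; the value [1 / 31] keeps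
   [e] below [1 / 30]. *)
apply/lee_addgt0Pr => t t0; pose e : R := Num.min (t / 3) (1 / 31).
have e0 : 0 < e by rewrite lt_min !divr_gt0.
have e30 : e < 1 / 30 by apply: (@le_lt_trans _ _ (1 / 31)); [rewrite ge_min lexx orbT|lra].
have et : e <= t / 3 by rewrite ge_min lexx.
move: e e0 e30 et => e e0 e30 et.
have q0 : 0 < 5 / 6 + 2 * e by lra.
suff h : ((k%:R / (k%:R * (5 / 6 + 2 * e)))%:E <= competitive_ratio (@proportional R) P A)%E.
  apply: le_trans (leeD h (lexx t%:E)).
  rewrite -EFinD lee_fin invfM mulrA divff ?gt_eqF// mul1r.
  rewrite -lerBlDr -[leRHS]div1r ler_pdivlMr//.
  by have : 0 <= t * e; [rewrite mulr_ge0 ?ltW|lra].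
have [h1 h2] := branches_proportional k e0 e30.
have := expected_profit_bound P e0 e30 hA.
set I1 := blocks k _; set I2 := blocks k [:: _; _; 1 / 3 + e] => EE.
have E0 I : input_of (@proportional R) I -> (0 <= expected_profit P A I)%E.
  by move=> hI; rewrite /expected_profit unlock integral_ge0// => w _; rewrite lee_fin profit_ge0.
have b0 : 0 < k%:R * (5 / 6 + 2 * e) by rewrite mulr_gt0.
have O1 : k%:R <= OPT k I1.
  (* The late size [2 / 3 - 2 * e] complements the first block to 1; in [I2], [1 / 3 + e]
     complements the second. *)
  apply: (@OPT_blocks_ge _ _ _ [:: true; false; true]) => //=; first by lra.
  by rewrite !big_cons big_nil; lra.
have O2 : k%:R <= OPT k I2.
  apply: (@OPT_blocks_ge _ _ _ [:: false; true; true]) => //=; first by lra.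
  by rewrite !big_cons big_nil; lra.
(* The threshold is half of the bound [k%:R * (5 / 3 + 4 * e)] on the sum, so the two expectations
   cannot both exceed it. *)
have [E1|E1] := leP (expected_profit P A I1) (k%:R * (5 / 6 + 2 * e))%:E.
  exact: (competitive_ratio_ge h1 k0 b0 O1 (E0 _ h1) E1).
have [E2|E2] := leP (expected_profit P A I2) (k%:R * (5 / 6 + 2 * e))%:E.
  exact: (competitive_ratio_ge h2 k0 b0 O2 (E0 _ h2) E2).
have := lt_le_trans (lteD E1 E2) EE; rewrite -EFinD lte_fin.
by rewrite -mulrDr ltr_pM2l// => h; exfalso; move: h; lra.
Qed.
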